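(* Assume that $$\inf_{\Omega}\Big[\tfrac{1}{C_{PF}^2}-\tfrac{s^2}{\alpha^2|q|^2}\big(\mathrm{Re}(q)+|q|^2\,\mathrm{Re}(\gamma)\big)\Big]>0,$$ where $C_{PF}>0$ is the constant of the Poincaré–Friedrichs inequality on $I=[0,1]$, i.e. $\|v\|_{0,I}\le C_{PF}\,|v|_{1,I}$ for $v\in H_0^1(I)$, or that there exists $\delta_\star\in\{1,-1\}$ such that $$\inf_{\Omega}\Big[\tfrac{\delta_\star s^2}{\alpha^2|q|^2}\big(\mathrm{Im}(q)-|q|^2\,\mathrm{Im}(\gamma)\big)\Big]>0 .$$ Then there exists a constant $C>0$ such that $$\max_{r\in[0,R]}\|T(r)\psi\|_{1,I}\le C\,\|\psi\|_{0,I}\qquad\text{for all }\psi\in L^2(I).$$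
   Context: Data: $R>0$, $\alpha>0$; $q\in\mathbb C$, $q\neq0$; $s:[0,R]\to(0,\infty)$ smooth; $\mathcal D=\{(r,z):0\le z\le s(r),\,0\le r\le R\}$; $\beta:\mathcal D\to\mathbb C$ smooth; $\Omega=[0,R]\times[0,1]$; $\gamma(r,y)=\beta(r,y\,s(r))$ for $(r,y)\in\Omega$. In the infima $s=s(r)$, $\gamma=\gamma(r,y)$, $(r,y)\in\Omega$. For $r\in[0,R]$, $\Lambda(r):H^2(I)\cap H^1_0(I)\to L^2(I)$ is defined by $\Lambda(r)v=-v''-\frac{(1+q\,\gamma(r,\cdot))\,s^2(r)}{\alpha^2q}\,v$; it is assumed that $\Lambda(r)$ is invertible for all $r\in[0,R]$, and $T(r):=\Lambda(r)^{-1}$. All function spaces are complex-valued; $\|\cdot\|_{j,I}$ is the norm of the Sobolev space $H^j(I)$ (so $\|\cdot\|_{0,I}$ is the $L^2(I)$ norm) and $|v|_{1,I}=\|v'\|_{0,I}$. *)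

(* Defs.v *)
From HB Require Import structures.
From mathcomp Require Import all_boot all_order all_algebra.
From mathcomp Require Import all_classical all_reals all_analysis.
From mathcomp Require Import complex.
Set Implicit Arguments.
Unset Strict Implicit.
Unset Printing Implicit Defensive.
Import Order.TTheory GRing.Theory Num.Theory.
Import numFieldNormedType.Exports.
Import Normc.
Local Open Scope classical_set_scope.
Local Open Scope ring_scope.
Local Open Scope complex_scope.

(* C^oo: the iterated directional derivatives of all orders exist and are
   continuous (foldr applies them one after the other, along the list vs). *)
Definition smooth (R : realType) (V : normedModType R) (f : V -> R) : Prop :=
  forall vs : seq V,
    let g := foldr (fun v h x => 'D_v h x) f vs in
    continuous g /\ (forall x v, derivable g x v).

(* Smoothness on a closed set A is the existence of a smooth extension;
   only the values of f on A matter. *)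
Definition smooth_on (R : realType) (V : normedModType R) (A : set V)
    (f : V -> R) : Prop :=
  exists2 g : V -> R, smooth g & forall x, A x -> g x = f x.

Definition csmooth (R : realType) (V : normedModType R) (f : V -> R[i]) : Prop :=
  smooth (fun x => complex.Re (f x)) /\ smooth (fun x => complex.Im (f x)).

Definition csmooth_on (R : realType) (V : normedModType R) (A : set V)
    (f : V -> R[i]) : Prop :=
  smooth_on A (fun x => complex.Re (f x)) /\ smooth_on A (fun x => complex.Im (f x)).

Definition cderive (R : realType) (f : R -> R[i]) : R -> R[i] :=
  fun x => derive1 (fun t => complex.Re (f t)) x
             +i* derive1 (fun t => complex.Im (f t)) x.

Definition II (R : realType) : set R := `[0, 1]%classic.
Arguments II {R}.

Notation leb R := (@lebesgue_measure R).

Definition cintegral (R : realType) (f : R -> R[i]) : R[i] :=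
  (Rintegral (leb R) II (fun x => complex.Re (f x)))
    +i* (Rintegral (leb R) II (fun x => complex.Im (f x))).

(* Elements of L^2(I) and of the Sobolev spaces are handled through
   representatives R -> R[i]; they are compared with  _ = _ %[ae leb R in II],
   and their values outside I play no role. *)
Definition L2 (R : realType) (v : R -> R[i]) : Prop :=
  [/\ measurable_fun II (fun x => complex.Re (v x)),
      measurable_fun II (fun x => complex.Im (v x)) &
      (leb R).-integrable II (fun x => (normc (v x) ^+ 2)%:E)].

Definition norm0 (R : realType) (v : R -> R[i]) : R :=
  Num.sqrt (Rintegral (leb R) II (fun x => normc (v x) ^+ 2)).

(* C_c^oo(]0, 1[); the closure is bounded, hence compact. *)
Definition test_fun (R : realType) (phi : R -> R[i]) : Prop :=
  csmooth phi /\ closure [set x | phi x != 0] `<=` `]0, 1[%classic.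

Definition weak_derivative (R : realType) (v w : R -> R[i]) : Prop :=
  forall phi : R -> R[i], test_fun phi ->
    cintegral (fun x => v x * cderive phi x)
      = - cintegral (fun x => w x * phi x).

(* An element of H^1(I) (resp. H^2(I)) carries a representative of its weak
   derivative (resp. first and second weak derivatives), which is unique up to
   a.e. equality. *)
Record H1 (R : realType) := MkH1 {
  fn : R -> R[i];
  der : R -> R[i];
  fn_L2 : L2 fn;
  der_L2 : L2 der;
  der_weak : weak_derivative fn der
}.

Record H2 (R : realType) := MkH2 {
  H2_H1 :> H1 R;
  der2 : R -> R[i];
  der2_L2 : L2 der2;
  der2_weak : weak_derivative (der H2_H1) der2
}.

(* sqrt(|f|_0^2 + |f'|_0^2) for a function f with derivative f' *)
Definition graph_norm (R : realType) (f f' : R -> R[i]) : R :=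
  Num.sqrt (norm0 f ^+ 2 + norm0 f' ^+ 2).

Definition norm1 (R : realType) (v : H1 R) : R := graph_norm (fn v) (der v).

Definition seminorm1 (R : realType) (v : H1 R) : R := norm0 (der v).

(* H^1_0(I): the closure of C_c^oo(]0, 1[) in H^1(I). *)
Definition in_H10 (R : realType) (v : H1 R) : Prop :=
  exists2 phi : nat -> R -> R[i],
    (forall n, test_fun (phi n)) &
    graph_norm (fn v \- phi n) (der v \- cderive (phi n)) @[n --> \oo] --> (0 : R).

Definition Poincare_Friedrichs (R : realType) (CPF : R) : Prop :=
  forall v : H1 R, in_H10 v -> norm0 (fn v) <= CPF * seminorm1 v.

Definition domain (R : realType) (Rad : R) (s : R -> R) : set (R * R) :=
  [set p | 0 <= p.2 <= s p.1 /\ 0 <= p.1 <= Rad].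

Definition Omega (R : realType) (Rad : R) : set (R * R) :=
  `[0, Rad]%classic `*` `[0, 1]%classic.

Definition gamma (R : realType) (s : R -> R) (beta : R * R -> R[i]) (r y : R)
  : R[i] := beta (r, y * s r).

Definition Lambda (R : realType) (alpha : R) (q : R[i]) (s : R -> R)
    (beta : R * R -> R[i]) (r : R) (v : H2 R) : R -> R[i] :=
  fun y => - der2 v y
    - (1 + q * gamma s beta r y) * (s r ^+ 2)%:C / ((alpha ^+ 2)%:C * q) * fn v y.

(* T is the inverse of the operator L : H^2 \cap H^1_0 -> L^2; such a T exists
   iff L is bijective (modulo a.e. equality). *)
Definition is_inverse (R : realType) (L : H2 R -> R -> R[i])
    (T : (R -> R[i]) -> H2 R) : Prop :=
  forall psi, L2 psi ->
    [/\ in_H10 (T psi),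
        L (T psi) = psi %[ae leb R in II] &
        forall v : H2 R, in_H10 v -> L v = psi %[ae leb R in II] ->
          fn v = fn (T psi) %[ae leb R in II]].

Definition is_max (R : realType) (A : set R) (m : R) : Prop :=
  A m /\ ubound A m.

(* Main.v *)
Require Import Defs.
From mathcomp Require Import all_boot all_order all_algebra.
From mathcomp Require Import all_classical all_reals all_analysis.
From mathcomp Require Import complex measurable_realfun ring lra.
Import Order.TTheory GRing.Theory Num.Theory.
Import numFieldNormedType.Exports.
Import Normc.
Local Open Scope classical_set_scope.
Local Open Scope ring_scope.
Local Open Scope complex_scope.

(* Write T(r)psi = v and Lambda(r)v = -v'' - c(r,.)v with c = s^2/alpha^2 (1/q + gamma).
   Testing -v'' - c v = f against conj(v), which is allowed by density of the
   test functions in H^1_0, gives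
     |v'|^2 - int Re(c)|v|^2 = Re(f, v)  and  - int Im(c)|v|^2 = Im(f, v).
   With Poincare-Friedrichs, either hypothesis yields kappa |v|^2 <= |f||v|, and then
   the first identity bounds |v'|; the constant depends only on kappa and sup Re(c).
   The maximum over r exists because r |-> |T(r)psi|_1 is continuous:
   w = T(r)psi - T(r0)psi solves Lambda(r)w = (c(r,.) - c(r0,.)) T(r0)psi, so the
   same estimate bounds w by sup_y |c(r,y) - c(r0,y)|, which tends to 0 as r -> r0. *)

Set Implicit Arguments.
Unset Strict Implicit.

(** * Real square-integrable functions on I and their inner product *)

Section SquareIntegrable.
Context {R : realType}.
Implicit Types f g h k : R -> R.

Definition integ (f : R -> R) := (leb R).-integrable II (EFin \o f).

Definition sqint (f : R -> R) :=
  measurable_fun II f /\ integ (fun x => f x ^+ 2).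

Definition ip (f g : R -> R) : R := Rintegral (leb R) II (fun x => f x * g x).

Lemma measurable_II : measurable (@II R : set (measurableTypeR R)).
Proof. exact: measurable_itv. Qed.

Lemma ipC f g : ip f g = ip g f.
Proof. by apply: eq_Rintegral => x _; rewrite mulrC. Qed.

Lemma integD f g : integ f -> integ g -> integ (fun x => f x + g x).
Proof.
move=> hf hg; have := integrableD measurable_II hf hg.
by apply: eq_integrable => //; exact: measurable_II.
Qed.

Lemma integZ (c : R) f : integ f -> integ (fun x => c * f x).
Proof.
move=> hf; have := integrableZl measurable_II c hf.
by apply: eq_integrable => //; exact: measurable_II.
Qed.

Lemma integ_le f g : measurable_fun II f -> integ g ->
  (forall x, II x -> `|f x| <= g x) -> integ f.
Proof.
move=> mf ig fg; apply: (le_integrable measurable_II _ _ ig).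
  exact/measurable_EFinP.
move=> x Ix /=; rewrite lee_fin; apply: le_trans (fg x Ix) _.
exact: ler_norm.
Qed.

(** The product is dominated by f^2 + g^2. *)
Lemma sqint_mul f g : sqint f -> sqint g -> integ (fun x => f x * g x).
Proof.
move=> [mf hf] [mg hg]; apply: integ_le (integD hf hg) _.
  exact: measurable_funM.
by move=> x _ /=; rewrite ler_norml; apply/andP; split; nra.
Qed.

Lemma sqintZ (c : R) f : sqint f -> sqint (fun x => c * f x).
Proof.
move=> [mf hf]; split; first by apply: measurable_funM => //; exact: measurable_cst.
have := integZ (c ^+ 2) hf; congr integ.
by apply/funext => x; rewrite exprMn.
Qed.

Lemma sqintD f g : sqint f -> sqint g -> sqint (fun x => f x + g x).
Proof.
move=> sf sg; have [mf hf] := sf; have [mg hg] := sg.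
split; first exact: measurable_funD.
have := integD (integD hf hg) (integZ 2 (sqint_mul sf sg)); congr integ.
by apply/funext => x; ring.
Qed.

Lemma sqintN f : sqint f -> sqint (fun x => - f x).
Proof.
by move=> /(sqintZ (-1)); congr sqint; apply/funext => x; rewrite mulN1r.
Qed.

Lemma sqintB f g : sqint f -> sqint g -> sqint (fun x => f x - g x).
Proof. by move=> sf /sqintN; exact: sqintD. Qed.

Lemma continuous_bounded_II k : continuous k ->
  exists M, forall x, II x -> `|k x| <= M.
Proof.
move=> ck; have /compact_bounded[M [_ hM]] :
    compact (k @` II).
  apply: continuous_compact; last exact: segment_compact.
  exact: continuous_subspaceT.
exists (M + 1) => x Ix; apply: (hM (M + 1)); first by rewrite ltrDl.
by exists x.
Qed.

Lemma continuous_measurable_II k : continuous k -> measurable_fun II k.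
Proof.
move=> ck; apply: measurable_funTS; exact: continuous_measurable_fun.
Qed.

(** On the compact I, [k] is bounded by some M, so M^2 f^2 dominates the square. This handles the
    coefficients of the equation. *)
Lemma sqintM k f : continuous k -> sqint f -> sqint (fun x => k x * f x).
Proof.
move=> ck [mf hf]; have [M hM] := continuous_bounded_II ck.
have mkf : measurable_fun II (fun x => k x * f x).
  by apply: measurable_funM => //; exact: continuous_measurable_II.
split=> //; apply: integ_le (integZ (M ^+ 2) hf) _.
  exact: measurable_funX.
move=> x Ix /=; rewrite ger0_norm ?sqr_ge0// exprMn ler_wpM2r ?sqr_ge0//.
by rewrite -real_normK ?num_real// lerXn2r ?nnegrE ?normr_ge0 ?hM// (le_trans _ (hM x Ix)).
Qed.

Lemma sqint1 : sqint (cst 1).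
Proof.
split; first exact: measurable_cst.
have -> : (fun x : R => cst 1 x ^+ 2) = cst 1 :> (R -> R).
  by apply/funext => x /=; rewrite expr1n.
apply: continuous_compact_integrable; first exact: segment_compact.
by apply: continuous_subspaceT => x; exact: cvg_cst.
Qed.

Lemma sqint_continuous k : continuous k -> sqint k.
Proof.
move=> /sqintM/(_ sqint1); congr sqint; apply/funext => x; exact: mulr1.
Qed.

Lemma ipDl f g h : sqint f -> sqint g -> sqint h ->
  ip (fun x => f x + g x) h = ip f h + ip g h.
Proof.
move=> sf sg sh; rewrite -RintegralD//; last 3 first.
- exact: measurable_II.
- exact: sqint_mul.
- exact: sqint_mul.
by apply: eq_Rintegral => x _; rewrite mulrDl.
Qed.

Lemma ipZl (c : R) f g : sqint f -> sqint g ->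
  ip (fun x => c * f x) g = c * ip f g.
Proof.
move=> sf sg; rewrite -RintegralZl//; last 2 first.
- exact: measurable_II.
- exact: sqint_mul.
by apply: eq_Rintegral => x _; rewrite mulrA.
Qed.

Lemma ipNl f g : sqint f -> sqint g -> ip (fun x => - f x) g = - ip f g.
Proof.
move=> sf sg; rewrite -[RHS]mulN1r -ipZl//; apply: eq_Rintegral => x _.
by rewrite mulN1r.
Qed.

Lemma ipBl f g h : sqint f -> sqint g -> sqint h ->
  ip (fun x => f x - g x) h = ip f h - ip g h.
Proof.
by move=> sf sg sh; rewrite ipDl ?ipNl//; exact: sqintN.
Qed.

Lemma ip_ge0 f : 0 <= ip f f.
Proof. by apply: Rintegral_ge0 => x _; rewrite -expr2 sqr_ge0. Qed.

Lemma le_ip f g h k : sqint f -> sqint g -> sqint h -> sqint k ->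
  (forall x, II x -> f x * g x <= h x * k x) -> ip f g <= ip h k.
Proof.
move=> sf sg sh sk H; apply: le_Rintegral => //; first exact: measurable_II.
- exact: sqint_mul.
- exact: sqint_mul.
Qed.

(** Expand 0 <= |t f - e g|^2 with e = 1 or e = -1 according to the sign of (f, g), and divide by t.
    This inequality does the work of Cauchy-Schwarz in all later estimates. *)
Lemma ip_young (t : R) f g : 0 < t -> sqint f -> sqint g ->
  2 * `|ip f g| <= t * ip f f + t^-1 * ip g g.
Proof.
move=> t0 sf sg.
have key e : e ^+ 2 = 1 -> 2 * (e * ip f g) <= t * ip f f + t^-1 * ip g g.
  move=> e2; have := ip_ge0 (fun x => t * f x + (- e) * g x).
  have sT : sqint (fun x => t * f x + (- e) * g x) by apply: sqintD; exact: sqintZ.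
  rewrite ipDl ?ipZl ?(ipC _ (fun x => _ + _)) ?ipDl ?ipZl//; try exact: sqintZ.
  rewrite (ipC g f).
  set F := ip f f; set G := ip g g; set X := ip f g => H.
  have -> : t * F + t^-1 * G = t^-1 * (t ^+ 2 * F + e ^+ 2 * G) by rewrite e2; field; lra.
  rewrite -ler_pdivrMl ?invr_gt0// invrK.
  by nra.
case: (ger0P (ip f g)) => _; first by rewrite -[X in 2 * X]mul1r; apply: key; rewrite expr1n.
by rewrite -mulN1r; apply: key; rewrite sqrrN expr1n.
Qed.

Lemma ae_eq_ipl f g h : sqint f -> sqint g -> sqint h ->
  f = g %[ae leb R in II] -> ip f h = ip g h.
Proof.
move=> [mf _] [mg _] [mh _] fg; congr fine; apply: ae_eq_integral.
- exact: measurable_II.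
- by apply/measurable_EFinP; exact: measurable_funM.
- by apply/measurable_EFinP; exact: measurable_funM.
- by apply: (@filterS _ _ (ae_filter_ringOfSetsType (leb R)) _ _ _ fg) => x /= fgx Ix; rewrite fgx.
Qed.

End SquareIntegrable.

(** * Weak derivatives through real and imaginary parts, and Green's formula *)

Section Sobolev.
Context {R : realType}.
Implicit Types (f g h : R -> R) (v w phi psi : R -> R[i]).

Definition re v : R -> R := fun x => complex.Re (v x).
Definition im v : R -> R := fun x => complex.Im (v x).

Lemma normc_sqr (z : R[i]) : normc z ^+ 2 = complex.Re z ^+ 2 + complex.Im z ^+ 2.
Proof. by case: z => a b /=; rewrite sqr_sqrtr// addr_ge0// sqr_ge0. Qed.

Lemma L2P v : L2 v <-> sqint (re v) /\ sqint (im v).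
Proof.
split=> [[mr mi iv]|[[mr ir] [mi ii]]].
  split; split=> //; apply: (integ_le _ iv); try exact: measurable_funX.
  - move=> x _; rewrite /= normc_sqr ger0_norm ?sqr_ge0// lerDl sqr_ge0//.
  - move=> x _; rewrite /= normc_sqr ger0_norm ?sqr_ge0// lerDr sqr_ge0//.
split=> //; have := integD ir ii; congr ((leb R).-integrable _ _).
by apply/funext => x /=; rewrite normc_sqr.
Qed.

Lemma norm0_sqr v : L2 v ->
  norm0 v ^+ 2 = ip (re v) (re v) + ip (im v) (im v).
Proof.
move=> /L2P[sr si]; rewrite /norm0 sqr_sqrtr; last first.
  by apply: Rintegral_ge0 => x _; rewrite sqr_ge0.
rewrite -RintegralD; last 3 first.
- exact: measurable_II.
- exact: sqint_mul.
- exact: sqint_mul.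
by apply: eq_Rintegral => x _; rewrite normc_sqr !expr2.
Qed.

Lemma reB v w : re (v \- w) = (fun x => re v x - re w x).
Proof. by apply/funext => x; rewrite /re /=; case: (v x) (w x) => ? ? []. Qed.

Lemma imB v w : im (v \- w) = (fun x => im v x - im w x).
Proof. by apply/funext => x; rewrite /im /=; case: (v x) (w x) => ? ? []. Qed.

Lemma L2B v w : L2 v -> L2 w -> L2 (v \- w).
Proof.
move=> /L2P[sv1 sv2] /L2P[sw1 sw2]; apply/L2P.
by rewrite reB imB; split; exact: sqintB.
Qed.

Definition real_test h :=
  smooth h /\ closure [set x | h x != 0] `<=` `]0, 1[%classic.

Definition weakR g g' :=
  forall h, real_test h -> ip g (derive1 h) = - ip g' h.

Lemma smooth_continuous (V : normedModType R) (f : V -> R) : smooth f -> continuous f.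
Proof. by move=> /(_ [::])[]. Qed.

Lemma smooth_derivable f : smooth f -> forall x, derivable f x 1.
Proof. by move=> /(_ [::])[_ H] x; exact: H. Qed.

Lemma smooth_derive1_continuous f : smooth f -> continuous (derive1 f).
Proof.
move=> /(_ [:: 1])[/= H _].
by have -> : derive1 f = (fun x => 'D_1 f x) by apply/funext => x; rewrite derive1E.
Qed.

Lemma smooth_cst (V : normedModType R) (c : R) : smooth (cst c : V -> R).
Proof.
move=> vs; have [d ->] : exists d,
    foldr (fun (u : V) (k : V -> R) x => 'D_u k x) (cst c) vs
    = cst d :> (V -> R).
  elim: vs => [|u vs [d IH]]; first by exists c.
  by exists 0; rewrite /= IH; apply/funext => x; rewrite derive_cst.
by split=> [x|x u]; [exact: cvg_cst|exact: derivable_cst].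
Qed.

Lemma smoothB (V : normedModType R) (f g : V -> R) :
  smooth f -> smooth g -> smooth (fun x => f x - g x).
Proof.
move=> sf sg vs.
have -> : foldr (fun (u : V) (k : V -> R) x => 'D_u k x) (fun x => f x - g x) vs =
    foldr (fun (u : V) (k : V -> R) x => 'D_u k x) f vs \-
    foldr (fun (u : V) (k : V -> R) x => 'D_u k x) g vs.
  elim: vs => [//|u vs /= ->]; apply/funext => x.
  by rewrite /= deriveB//; [apply: (sf vs).2|apply: (sg vs).2].
have [cf df] := sf vs; have [cg dg] := sg vs.
split=> [x|x u]; first exact: cvgB (cf x) (cg x).
exact: derivableB.
Qed.

Lemma closure_sub_supp (A B : set R) : A `<=` B -> closure B `<=` `]0, 1[%classic ->
  closure A `<=` `]0, 1[%classic.
Proof. by move=> AB; apply: subset_trans; exact: closure_subset. Qed.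

Lemma test_fun_re phi : test_fun phi -> real_test (re phi).
Proof.
move=> [[sr _] supp]; split=> //; apply: closure_sub_supp supp => x /=.
by apply: contra => /eqP; rewrite /re => ->.
Qed.

Lemma test_fun_im phi : test_fun phi -> real_test (im phi).
Proof.
move=> [[_ si] supp]; split=> //; apply: closure_sub_supp supp => x /=.
by apply: contra => /eqP; rewrite /im => ->.
Qed.

Lemma test_fun_real h : real_test h -> test_fun (fun x => (h x)%:C).
Proof.
move=> [sh supp]; split; first by split=> //; exact: smooth_cst.
apply: closure_sub_supp supp => x /=.
by apply: contra => /eqP ->.
Qed.

Lemma test_funB phi psi : test_fun phi -> test_fun psi -> test_fun (phi \- psi).
Proof.
move=> [[pr pi] ps] [[qr qi] qs]; split.
  split.
    by have := smoothB pr qr;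
      congr smooth; apply/funext => x; rewrite -[RHS]/(re (phi \- psi) x) reB.
  by have := smoothB pi qi;
      congr smooth; apply/funext => x; rewrite -[RHS]/(im (phi \- psi) x) imB.
apply: (@closure_sub_supp _ ([set x | phi x != 0] `|` [set x | psi x != 0])).
  move=> x /=; have [->|] := eqVneq (phi x) 0; last by left.
  by rewrite sub0r oppr_eq0; right.
by rewrite closureU => x [/ps|/qs].
Qed.

Lemma cderiveB phi psi : csmooth phi -> csmooth psi ->
  cderive (phi \- psi) = cderive phi \- cderive psi.
Proof.
move=> [pr pi] [qr qi]; apply/funext => x; rewrite /cderive.
have -> : (fun t => complex.Re ((phi \- psi) t)) =
    (fun t => complex.Re (phi t)) \- (fun t => complex.Re (psi t)) := reB phi psi.
have -> : (fun t => complex.Im ((phi \- psi) t)) =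
    (fun t => complex.Im (phi t)) \- (fun t => complex.Im (psi t)) := imB phi psi.
rewrite !derive1E !deriveB//; try exact: smooth_derivable.
by rewrite /= !derive1E.
Qed.

Lemma L2_test phi : test_fun phi -> L2 phi /\ L2 (cderive phi).
Proof.
move=> [[sr si] _]; split; apply/L2P; split; apply: sqint_continuous.
- exact: smooth_continuous.
- exact: smooth_continuous.
- exact: smooth_derive1_continuous.
- exact: smooth_derive1_continuous.
Qed.

Lemma cintegralM v w : L2 v -> L2 w -> cintegral (fun x => v x * w x) =
  (ip (re v) (re w) - ip (im v) (im w)) +i* (ip (re v) (im w) + ip (im v) (re w)).
Proof.
move=> /L2P[vr vi] /L2P[wr wi]; rewrite /cintegral -RintegralB -?RintegralD;
  try exact: sqint_mul; try exact: measurable_II.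
by congr (_ +i* _); apply: eq_Rintegral => x _; rewrite /re /im;
  case: (v x) (w x) => ? ? [].
Qed.

(** A real test function has zero imaginary part, so the complex identity splits into its two
    components. Conversely, both parts of a complex test function are real test functions, and the
    four products recombine. *)
Lemma weak_derivativeP v w : L2 v -> L2 w ->
  weak_derivative v w <-> weakR (re v) (re w) /\ weakR (im v) (im w).
Proof.
move=> v2 w2; split=> [vw|[wr wi] phi tphi].
  have H h : real_test h -> ip (re v) (derive1 h) = - ip (re w) h /\
      ip (im v) (derive1 h) = - ip (im w) h.
    move=> th; have tc := test_fun_real th; have [l2 l2'] := L2_test tc.
    have := vw _ tc; rewrite !cintegralM//.
    have -> : im (fun x => (h x)%:C) = cst 0 by [].
    have -> : im (cderive (fun x => (h x)%:C)) = cst 0.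
      by apply/funext => x; rewrite /im /= derive1_cst.
    have ip0 f : ip f (cst 0) = 0.
      rewrite -[RHS](mul0r (fine (leb R II))) -Rintegral_cst; last exact: measurable_II.
      by apply: eq_Rintegral => x _ /=; rewrite mulr0.
    by rewrite !ip0 !subr0 !add0r => -[-> ->].
  by split=> h /H[].
have [l2 l2'] := L2_test tphi; rewrite !cintegralM//.
have tr := test_fun_re tphi; have ti := test_fun_im tphi.
have -> : re (cderive phi) = derive1 (re phi) by [].
have -> : im (cderive phi) = derive1 (im phi) by [].
rewrite !wr// !wi//; apply/eqP; rewrite eq_complex /=; apply/andP.
by split; apply/eqP; ring.
Qed.

Lemma weakRB f g f' g' : sqint f -> sqint g -> sqint f' -> sqint g' ->
  weakR f f' -> weakR g g' ->
  weakR (fun x => f x - g x) (fun x => f' x - g' x).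
Proof.
move=> sf sg sf' sg' wf wg h th; have [sh _] := th.
have sqh : sqint h by apply: sqint_continuous; exact: smooth_continuous.
have sqh' : sqint (derive1 h).
  by apply: sqint_continuous; exact: smooth_derive1_continuous.
by rewrite !ipBl// wf// wg//; ring.
Qed.

Lemma weak_derivativeB v v' w w' : L2 v -> L2 v' -> L2 w -> L2 w' ->
  weak_derivative v w -> weak_derivative v' w' ->
  weak_derivative (v \- v') (w \- w').
Proof.
move=> v2 v2' w2 w2' /weak_derivativeP[]// r1 i1 /weak_derivativeP[]// r2 i2.
move/L2P: (v2) => [? ?]; move/L2P: (v2') => [? ?].
move/L2P: (w2) => [? ?]; move/L2P: (w2') => [? ?].
apply/weak_derivativeP; [exact: L2B|exact: L2B|].
by rewrite !reB !imB; split; exact: weakRB.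
Qed.

(** Membership in H^1_0 for a single real component, with the squared graph norm and an arbitrary
    accuracy instead of a sequence. *)
Definition H10_approx a a' :=
  forall e : R, 0 < e -> exists2 h, real_test h &
    ip (fun x => a x - h x) (fun x => a x - h x) +
    ip (fun x => a' x - derive1 h x) (fun x => a' x - derive1 h x) <= e.

Lemma green p p' a a' : sqint p -> sqint p' -> sqint a -> sqint a' ->
  weakR p p' -> H10_approx a a' -> ip p a' = - ip p' a.
Proof.
(* The defect equals ip p (a' - h') + ip p' (a - h) for every test function h. *)
move=> sp sp' sa sa' wp ap; apply/eqP; rewrite -subr_eq0 opprK -normr_le0.
apply/ler_addgt0Pl => e e0; rewrite addr0.
have K0 := ip_ge0 p; have K0' := ip_ge0 p'.
set K := ip p p + ip p' p'.
(* With this Young parameter t K <= e. Taking [h] with squared error at most t e makes the other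
   Young term, t^-1 times that error, at most e as well. The 1 keeps the denominator positive. *)
pose t := e / (K + 1).
have t0 : 0 < t by rewrite divr_gt0// /K; lra.
have [h th Hh] := ap (t * e) ltac:(nra).
have [sh _] := th.
have sqh : sqint h by apply: sqint_continuous; exact: smooth_continuous.
have sqh' : sqint (derive1 h) by apply: sqint_continuous; exact: smooth_derive1_continuous.
set d := fun x => a x - h x in Hh; set d' := fun x => _ in Hh.
have sd : sqint d by exact: sqintB.
have sd' : sqint d' by exact: sqintB.
have -> : ip p a' + ip p' a = ip p d' + ip p' d.
  rewrite (ipC p d') (ipC p' d) !ipBl// (ipC a') (ipC a) (ipC _ p) (ipC _ p').
  by rewrite wp//; ring.
have y1 := ip_young t0 sp sd'; have y2 := ip_young t0 sp' sd.
have tK : t * K <= e.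
  by rewrite /t mulrAC ler_pdivrMr /K; nra.
have Q : t^-1 * ip d d + t^-1 * ip d' d' <= e.
  by rewrite -mulrDr ler_pdivrMl.
apply: le_trans (ler_normD _ _) _.
by rewrite /K in tK; nra.
Qed.

End Sobolev.

(** * Energy identities, a priori estimate and perturbation of the coefficients *)

Section Energy.
Context {R : realType}.
Implicit Types (f g h : R -> R) (v w phi psi : R -> R[i]).

Lemma graph_norm_sqr v w : graph_norm v w ^+ 2 = norm0 v ^+ 2 + norm0 w ^+ 2.
Proof. by rewrite /graph_norm sqr_sqrtr// addr_ge0// sqr_ge0. Qed.

Lemma norm0_ge0 v : 0 <= norm0 v. Proof. exact: sqrtr_ge0. Qed.

Lemma graph_norm_ge0 v w : 0 <= graph_norm v w. Proof. exact: sqrtr_ge0. Qed.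

Lemma sqint_re v : L2 v -> sqint (re v). Proof. by move=> /L2P[]. Qed.

Lemma sqint_im v : L2 v -> sqint (im v). Proof. by move=> /L2P[]. Qed.

(** The squared graph norm is the sum of the nonnegative contributions of the real and the imaginary
    part, so it controls each of them. *)
Lemma in_H10_approx (v : H1 R) : in_H10 v ->
  H10_approx (re (fn v)) (re (der v)) /\ H10_approx (im (fn v)) (im (der v)).
Proof.
move=> [phi tphi phiv].
have H e : 0 < e -> exists2 n, test_fun (phi n) &
    graph_norm (fn v \- phi n) (der v \- cderive (phi n)) ^+ 2 <= e.
  move=> e0; have se0 : 0 < Num.sqrt e by rewrite sqrtr_gt0.
  move/cvgr0Pnorm_le : phiv => /(_ _ se0)[N _ /(_ N (leqnn N))] /=.
  rewrite ger0_norm ?graph_norm_ge0// => le_e; exists N => //.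
  by rewrite -[leRHS](sqr_sqrtr (ltW e0)) ler_pXn2r ?nnegrE ?graph_norm_ge0// ltW.
split=> e /H[n tn]; have [l2 l2'] := L2_test tn;
  rewrite graph_norm_sqr (norm0_sqr (L2B (fn_L2 v) l2))
    (norm0_sqr (L2B (der_L2 v) l2')) !reB !imB => le_e.
- exists (re (phi n)); first exact: test_fun_re.
  apply: le_trans le_e; rewrite lerD// lerDl; exact: ip_ge0.
- exists (im (phi n)); first exact: test_fun_im.
  apply: le_trans le_e; rewrite lerD// lerDr; exact: ip_ge0.
Qed.

Definition H1B (u v : H1 R) : H1 R :=
  MkH1 (L2B (fn_L2 u) (fn_L2 v)) (L2B (der_L2 u) (der_L2 v))
    (weak_derivativeB (fn_L2 u) (fn_L2 v) (der_L2 u) (der_L2 v)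
      (der_weak u) (der_weak v)).

Definition H2B (u v : H2 R) : H2 R :=
  @MkH2 R (H1B u v) (der2 u \- der2 v) (L2B (der2_L2 u) (der2_L2 v))
    (weak_derivativeB (der_L2 u) (der_L2 v) (der2_L2 u) (der2_L2 v)
      (der2_weak u) (der2_weak v)).

Lemma ip_sqrB f g : sqint f -> sqint g ->
  ip (fun x => f x - g x) (fun x => f x - g x) =
  ip f f - 2 * ip f g + ip g g.
Proof.
move=> sf sg; have sfg := sqintB sf sg.
by rewrite ipBl// !(ipC _ (fun x => _ - _)) !ipBl// (ipC g f); ring.
Qed.

Lemma ip_sqrB_le f g : sqint f -> sqint g ->
  ip (fun x => f x - g x) (fun x => f x - g x) <= 2 * ip f f + 2 * ip g g.
Proof.
move=> sf sg; rewrite ip_sqrB//; have := ip_young ltr01 sf sg.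
by rewrite invr1 !mul1r; have := ler_norm (- ip f g); rewrite normrN; lra.
Qed.

Lemma norm0_sqrB_le v w : L2 v -> L2 w ->
  norm0 (v \- w) ^+ 2 <= 2 * norm0 v ^+ 2 + 2 * norm0 w ^+ 2.
Proof.
move=> v2 w2; rewrite (norm0_sqr (L2B v2 w2)) !norm0_sqr// reB imB.
have := ip_sqrB_le (sqint_re v2) (sqint_re w2).
have := ip_sqrB_le (sqint_im v2) (sqint_im w2); lra.
Qed.

(** A triangle inequality with a crude factor 2, obtained from |x - y|^2 <= 2|x|^2 + 2|y|^2. The
    factor is harmless because only convergence to 0 is deduced from it. *)
Lemma graph_normB_le v v' w w' : L2 v -> L2 v' -> L2 w -> L2 w' ->
  graph_norm (v \- w) (v' \- w') <= 2 * (graph_norm v v' + graph_norm w w').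
Proof.
move=> v2 v2' w2 w2'.
have g0 := graph_norm_ge0 v v'; have g0' := graph_norm_ge0 w w'.
rewrite -(@ler_pXn2r _ 2) ?nnegrE ?graph_norm_ge0//; last nra.
have h1 := norm0_sqrB_le v2 w2; have h2 := norm0_sqrB_le v2' w2'.
have := graph_norm_sqr (v \- w) (v' \- w').
have := graph_norm_sqr v v'; have := graph_norm_sqr w w'.
nra.
Qed.

Lemma in_H10B (u v : H1 R) : in_H10 u -> in_H10 v -> in_H10 (H1B u v).
Proof.
move=> [phi tphi phiu] [psi tpsi psiv]; exists (fun n => phi n \- psi n).
  by move=> n; exact: test_funB.
have := cvgM (cvg_cst (2 : R)) (cvgD phiu psiv); rewrite addr0 mulr0 => H.
apply: (squeeze_cvgr _ (cvg_cst 0)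
  (h := cst 2 \* (fun n =>
    graph_norm (fn u \- phi n) (der u \- cderive (phi n)) +
    graph_norm (fn v \- psi n) (der v \- cderive (psi n)))));
  last exact: H.
apply: nearW => n; rewrite graph_norm_ge0 /=.
have [l2 l2'] := L2_test (tphi n); have [m2 m2'] := L2_test (tpsi n).
apply: le_trans (graph_normB_le _ _ _ _); last 4 first.
- exact: (L2B (fn_L2 u) l2).
- exact: (L2B (der_L2 u) l2').
- exact: (L2B (fn_L2 v) m2).
- exact: (L2B (der_L2 v) m2').
(* Both sides agree after the regrouping (u - v) - (phi - psi) = (u - phi) - (v - psi). *)
rewrite le_eqVlt; apply/orP; left; apply/eqP; congr graph_norm.
  by apply/funext => x /=; ring.
rewrite cderiveB; [|by case: (tphi n)|by case: (tpsi n)].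
by apply/funext => x /=; ring.
Qed.

(** The square is a sum of inner products, so all estimates are free of square roots until the very
    end. *)
Definition energy (v : H1 R) : R := norm1 v ^+ 2.

Lemma energyE (v : H1 R) : energy v =
  ip (re (fn v)) (re (fn v)) + ip (im (fn v)) (im (fn v)) +
  (ip (re (der v)) (re (der v)) + ip (im (der v)) (im (der v))).
Proof.
rewrite /energy /norm1 graph_norm_sqr !norm0_sqr//;
  [exact: der_L2|exact: fn_L2].
Qed.

(** From |f|^2 - |g|^2 = |f - g|^2 + 2 (g, f - g), with Young's inequality on the cross term. *)
Lemma ip_sqr_near (t : R) f g : 0 < t -> sqint f -> sqint g ->
  `|ip f f - ip g g| <= (1 + t^-1) * ip (fun x => f x - g x) (fun x => f x - g x)
     + t * ip g g.
Proof.
move=> t0 sf sg; have sd := sqintB sf sg.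
have := ip_young t0 sg sd.
have -> : ip g (fun x => f x - g x) = ip f g - ip g g by rewrite ipC ipBl.
have dE := ip_sqrB sf sg; have := ip_ge0 (fun x => f x - g x).
move: dE; set D := ip (fun x => f x - g x) _ => dE D0.
have := ler_norm (ip f g - ip g g); have := ler_norm (- (ip f g - ip g g)).
rewrite normrN => n1 n2 y; rewrite ler_norml; apply/andP; split; lra.
Qed.

Lemma energy_near (t : R) (u v : H1 R) : 0 < t ->
  `|energy u - energy v| <= (1 + t^-1) * energy (H1B u v) + t * energy v.
Proof.
move=> t0; rewrite !energyE /= !reB !imB.
have h1 := ip_sqr_near t0 (sqint_re (fn_L2 u)) (sqint_re (fn_L2 v)).
have h2 := ip_sqr_near t0 (sqint_im (fn_L2 u)) (sqint_im (fn_L2 v)).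
have h3 := ip_sqr_near t0 (sqint_re (der_L2 u)) (sqint_re (der_L2 v)).
have h4 := ip_sqr_near t0 (sqint_im (der_L2 u)) (sqint_im (der_L2 v)).
move: h1 h2 h3 h4; rewrite !ler_norml.
by move=> /andP[? ?] /andP[? ?] /andP[? ?] /andP[? ?]; apply/andP; split; lra.
Qed.

(* The real and imaginary parts of -v'' - (cr + i ci) v = f + i g. *)
Definition solves (v : H2 R) (cr ci f g : R -> R) :=
  re (der2 v) = (fun y => - (cr y * re (fn v) y - ci y * im (fn v) y + f y))
    %[ae leb R in II] /\
  im (der2 v) = (fun y => - (cr y * im (fn v) y + ci y * re (fn v) y + g y))
    %[ae leb R in II].

Section Estimate.
Variables (v : H2 R) (cr ci f g : R -> R).
Hypotheses (ccr : continuous cr) (cci : continuous ci).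
Hypotheses (sf : sqint f) (sg : sqint g).
Hypotheses (H10v : in_H10 v) (sol : solves v cr ci f g).
Local Notation a := (re (fn v)).
Local Notation b := (im (fn v)).
Local Notation a' := (re (der v)).
Local Notation b' := (im (der v)).

Let sa : sqint a := sqint_re (fn_L2 v).
Let sb : sqint b := sqint_im (fn_L2 v).
Let sa' : sqint a' := sqint_re (der_L2 v).
Let sb' : sqint b' := sqint_im (der_L2 v).
Let scra : sqint (fun y => cr y * a y) := sqintM ccr sa.
Let scrb : sqint (fun y => cr y * b y) := sqintM ccr sb.
Let scia : sqint (fun y => ci y * a y) := sqintM cci sa.
Let scib : sqint (fun y => ci y * b y) := sqintM cci sb.

(** First identity: test the real equation with a and the imaginary one with b, then add; the [ci]
    terms cancel. Second identity: compute (a', b') = (b', a') by Green's formula in both orders;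
    the [cr] terms cancel. *)
Lemma energy_identities :
  ip a' a' + ip b' b' =
    ip (fun y => cr y * a y) a + ip (fun y => cr y * b y) b + ip f a + ip g b /\
  ip (fun y => ci y * a y) a + ip (fun y => ci y * b y) b = ip f b - ip g a.
Proof.
have [apa apb] := in_H10_approx H10v.
have [wa wb] := (weak_derivativeP (der_L2 v) (der2_L2 v)).1 (der2_weak v).
have s2a := sqint_re (der2_L2 v); have s2b := sqint_im (der2_L2 v).
have [ea eb] := sol.
have Ea h : sqint h -> - ip (re (der2 v)) h =
    ip (fun y => cr y * a y) h - ip (fun y => ci y * b y) h + ip f h.
  move=> sh; have s1 := sqintB scra scib.
  have s2 := sqintD s1 sf; rewrite (ae_eq_ipl s2a (sqintN s2) sh ea).
  by rewrite (ipNl s2 sh) opprK ipDl// ipBl.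
have Eb h : sqint h -> - ip (im (der2 v)) h =
    ip (fun y => cr y * b y) h + ip (fun y => ci y * a y) h + ip g h.
  move=> sh; have s1 := sqintD scrb scia.
  have s2 := sqintD s1 sg; rewrite (ae_eq_ipl s2b (sqintN s2) sh eb).
  by rewrite (ipNl s2 sh) opprK ipDl// ipDl.
have mulAC k : ip (fun y => k y * a y) b = ip (fun y => k y * b y) a.
  by apply: eq_Rintegral => y _; ring.
split.
  rewrite (green _ _ _ _ wa apa)// (green _ _ _ _ wb apb)// Ea// Eb//.
  by rewrite (mulAC ci); ring.
have := ipC a' b'.
rewrite (green _ _ _ _ wa apb)// (green _ _ _ _ wb apa)// Ea// Eb//.
by rewrite (mulAC cr); lra.
Qed.

(** The constant involves the coefficients only through [kappa] and [M], which makes the estimate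
    uniform in r. *)
Lemma a_priori (CPF kappa M : R) : 0 < CPF -> 0 < kappa -> 0 <= M ->
  Poincare_Friedrichs CPF ->
  (forall y, II y -> cr y <= M) ->
  (forall y, II y -> kappa <= 1 / CPF ^+ 2 - cr y) \/
  (exists delta, (delta = 1 \/ delta = -1) /\
    forall y, II y -> kappa <= - (delta * ci y)) ->
  energy v <= ((M + 2) / kappa ^+ 2 + 1) * (ip f f + ip g g).
Proof.
move=> CPF0 k0 M0 PF crM coer.
have [id1 id2] := energy_identities.
have F0 : 0 <= ip f f + ip g g by rewrite addr_ge0 ?ip_ge0.
have N00 : 0 <= ip a a + ip b b by rewrite addr_ge0 ?ip_ge0.
(* Both alternatives give kappa |v|^2 <= (x, z) + (y, u), where (x, y) is
   (f, g) up to signs and order and (z, u) is (a, b) or (b, a). *)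
have N0F : kappa ^+ 2 * (ip a a + ip b b) <= ip f f + ip g g.
  have fin x y z (u : R -> R) : sqint x -> sqint y -> ip x x + ip y y = ip f f + ip g g ->
      (z = a /\ u = b) \/ (z = b /\ u = a) ->
      kappa * (ip a a + ip b b) <= ip x z + ip y u ->
      kappa ^+ 2 * (ip a a + ip b b) <= ip f f + ip g g.
    move=> sx sy <- zu H.
    have sz : sqint z by case: zu => -[-> _].
    have su : sqint u by case: zu => -[_ ->].
    have zuE : ip z z + ip u u = ip a a + ip b b.
      by case: zu => -[-> ->]; rewrite // addrC.
    (* Young's inequality with parameter [kappa] lets half of the left-hand side absorb the terms in
       z and u. *)
    have y1 := ip_young k0 sz sx; have y2 := ip_young k0 su sy.
    have := ler_norm (ip z x); have := ler_norm (ip u y).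
    move: y1 y2; rewrite (ipC z x) (ipC u y) => y1 y2 n1 n2.
    have H2 : kappa * (ip a a + ip b b) <= kappa^-1 * (ip x x + ip y y).
      by rewrite -zuE in H *; lra.
    by rewrite expr2 -mulrA -ler_pdivlMl.
  case: coer => [coer|[delta [d1 coer]]].
    apply: (fin f g a b) => //; first by left.
    have low h : sqint h -> sqint (fun y => cr y * h y) ->
        kappa * ip h h <= CPF ^- 2 * ip h h - ip (fun y => cr y * h y) h.
      move=> sh sch; rewrite -!ipZl// -ipBl//; last exact: sqintZ.
      apply: le_ip => //; [exact: sqintZ|by apply: sqintB => //; exact: sqintZ|].
      move=> y /coer; rewrite div1r => H; rewrite -mulrBl -mulrA -[leRHS]mulrA.
      by rewrite ler_wpM2r// -expr2 sqr_ge0.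
    (* Poincare-Friedrichs replaces |v|^2 / CPF^2 by |v'|^2, and the first identity turns |v'|^2
       minus the [cr] terms into (f, a) + (g, b). *)
    have PFv := PF v H10v; rewrite /seminorm1 in PFv.
    have : norm0 (fn v) ^+ 2 <= CPF ^+ 2 * norm0 (der v) ^+ 2.
      by rewrite -exprMn ler_pXn2r// nnegrE ?norm0_ge0// mulr_ge0 ?norm0_ge0// ltW.
    rewrite !norm0_sqr; [|exact: der_L2|exact: fn_L2].
    rewrite -ler_pdivrMl ?exprn_gt0// => P.
    have := low _ sa scra; have := low _ sb scrb; lra.
  have low h : sqint h -> sqint (fun y => ci y * h y) ->
      kappa * ip h h <= - delta * ip (fun y => ci y * h y) h.
    move=> sh sch; rewrite -!ipZl//; apply: le_ip => //; try exact: sqintZ.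
    move=> y /coer H; rewrite !mulrA -mulrA -[leRHS]mulrA mulNr.
    by rewrite ler_wpM2r// -expr2 sqr_ge0.
  have := low _ sa scia; have := low _ sb scib => lb la.
  have key : kappa * (ip a a + ip b b) <= - delta * (ip f b - ip g a) by rewrite -id2; lra.
  have d2 : delta * delta = 1 by case: d1 => ->; rewrite ?mulrNN mulr1.
  apply: (fin (fun y => - delta * f y) (fun y => delta * g y) b a) => //.
  - exact: sqintZ.
  - exact: sqintZ.
  - have dd x e : sqint x -> e * e = 1 -> ip (fun t => e * x t) (fun t => e * x t) = ip x x.
      by move=> sx e2; apply: eq_Rintegral => t _; rewrite mulrACA e2 mul1r.
    by rewrite !dd// mulrNN.
  - by right.
  - by rewrite !ipZl//; lra.
have up h : sqint h -> sqint (fun y => cr y * h y) ->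
    ip (fun y => cr y * h y) h <= M * ip h h.
  move=> sh sch; rewrite -!ipZl//; apply: le_ip => //; first exact: sqintZ.
  by move=> y /crM H; rewrite -!mulrA ler_wpM2r// -expr2 sqr_ge0.
have ua := up _ sa scra; have ub := up _ sb scrb.
have y1 := ip_young ltr01 sf sa; have y2 := ip_young ltr01 sg sb.
have n1 := ler_norm (ip f a); have n2 := ler_norm (ip g b).
rewrite energyE id1.
(* The energy is |v|^2 + |v'|^2: the first term counts 1, the [cr] terms at most M, and Young's
   inequality on (f, a) + (g, b) another 1/2, so M + 2 is ample. *)
have : (M + 2) * (ip a a + ip b b) <= (M + 2) / kappa ^+ 2 * (ip f f + ip g g).
  rewrite -mulrA ler_wpM2l ?addr_ge0// ler_pdivlMl ?exprn_gt0//.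
move: y1 y2; rewrite invr1 !mul1r; lra.
Qed.

End Estimate.

(** Write c u - c0 v = c (u - v) + (c - c0) v: the common data cancel and (c - c0) v becomes the new
    right-hand side. The double negation gives both components the shape of a difference. *)
Lemma solvesB (u v : H2 R) cr ci cr0 ci0 f g :
  solves u cr ci f g -> solves v cr0 ci0 f g ->
  solves (H2B u v) cr ci
    (fun y => (cr y - cr0 y) * re (fn v) y - (ci y - ci0 y) * im (fn v) y)
    (fun y => (cr y - cr0 y) * im (fn v) y - (- (ci y - ci0 y)) * re (fn v) y).
Proof.
move=> [ur ui] [vr vi]; split; rewrite /= !reB !imB.
  apply: (@filterS2 _ _ (ae_filter_ringOfSetsType (leb R)) _ _ _ _ ur vr).
  by move=> x /= ux vx Ix; rewrite ux// vx//; ring.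
apply: (@filterS2 _ _ (ae_filter_ringOfSetsType (leb R)) _ _ _ _ ui vi).
by move=> x /= ux vx Ix; rewrite ux// vx//; ring.
Qed.

Lemma ip_mul_le (eta : R) (k h : R -> R) : continuous k -> sqint h -> 0 <= eta ->
  (forall y, II y -> `|k y| <= eta) ->
  ip (fun y => k y * h y) (fun y => k y * h y) <= eta ^+ 2 * ip h h.
Proof.
move=> ck sh eta0 keta; have skh := sqintM ck sh.
rewrite -ipZl//; apply: le_ip => //; first exact: sqintZ.
move=> y /keta H; rewrite mulrACA -[leRHS]mulrA ler_wpM2r//; first by rewrite -expr2 sqr_ge0.
rewrite -expr2 -real_normK ?num_real// lerXn2r//.
Qed.

(** Each of f and g contributes 2 eta^2 |v|^2, and |v|^2 is at most the energy. *)
Lemma perturbation (eta : R) (v : H1 R) (k l : R -> R) : continuous k -> continuous l ->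
  0 <= eta ->
  (forall y, II y -> `|k y| <= eta) -> (forall y, II y -> `|l y| <= eta) ->
  forall f g,
  f = (fun y => k y * re (fn v) y - l y * im (fn v) y) ->
  g = (fun y => k y * im (fn v) y - (- l y) * re (fn v) y) ->
  ip f f + ip g g <= 4 * eta ^+ 2 * energy v.
Proof.
move=> ck cl eta0 keta leta f g -> ->.
have sa := sqint_re (fn_L2 v); have sb := sqint_im (fn_L2 v).
have cl' : continuous (fun y => - l y) by move=> y; exact: cvgN (cl y).
have leta' y : II y -> `|- l y| <= eta by rewrite normrN; exact: leta.
have h1 := ip_sqrB_le (sqintM ck sa) (sqintM cl sb).
have h2 := ip_sqrB_le (sqintM ck sb) (sqintM cl' sa).
have := ip_mul_le ck sa eta0 keta; have := ip_mul_le ck sb eta0 keta.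
have := ip_mul_le cl sb eta0 leta; have := ip_mul_le cl' sa eta0 leta'.
have : 0 <= eta ^+ 2 * (ip (re (der v)) (re (der v)) + ip (im (der v)) (im (der v))).
  by rewrite mulr_ge0 ?sqr_ge0 ?addr_ge0 ?ip_ge0.
rewrite energyE; lra.
Qed.

End Energy.

(** * The coefficient of the equation: components, lower bounds, uniformity on compact sets *)

Section Coefficients.
Context {R : realType}.

Lemma normc_sqr_gt0 (q : R[i]) : q != 0 -> 0 < normc q ^+ 2.
Proof.
rewrite normc_sqr; case: q => a b; rewrite eq_complex /= negb_and.
by case/orP => h; [apply: ltr_pwDl|apply: ltr_wpDl];
  rewrite ?sqr_ge0// lt0r sqrf_eq0 h sqr_ge0.
Qed.

(** Since (1 + q z) / q = conj(q) / |q|^2 + z. The factor S / (A |q|^2) is pulled out to match the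
    expressions in the two infimum hypotheses. *)
Lemma quotient_components (q z : R[i]) (S A : R) : q != 0 -> A != 0 ->
  (1 + q * z) * S%:C / (A%:C * q) =
  (S / (A * normc q ^+ 2) * (complex.Re q + normc q ^+ 2 * complex.Re z))
  +i* (S / (A * normc q ^+ 2) * (normc q ^+ 2 * complex.Im z - complex.Im q)).
Proof.
move=> q0 A0; rewrite normc_sqr.
have Aq0 : A%:C * q != 0 by rewrite mulf_neq0// eq_complex /= negb_and A0.
apply: (mulIf Aq0); rewrite divfK//; case: q q0 {Aq0} => a b; rewrite eq_complex /= => ab.
case: z => c d.
have N0 : a ^+ 2 + b ^+ 2 != 0.
  rewrite paddr_eq0 ?sqr_ge0// !sqrf_eq0; exact: ab.
apply/eqP; rewrite eq_complex /=; apply/andP; split; apply/eqP; field; by rewrite A0 N0.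
Qed.

(** By convention [inf] is 0 on a set without a lower bound, so a positive value forces the set to
    be bounded below. *)
Lemma inf_gt0_lbound (E : set R) x : 0 < inf E -> E x -> inf E <= x.
Proof.
move=> i0 Ex; apply: ge_inf => //; apply: contrapT => nlb.
have : inf E = 0 by apply: inf_out => -[_ /nlb].
by move=> i0'; rewrite i0' ltxx in i0.
Qed.

(** Compactness of I in its near-covering form. Around each y, both F(r, y') and F(r0, y') lie
    within eta / 2 of F(r0, y). *)
Lemma near_segment_uniform (F : R * R -> R) (r0 eta : R) : continuous F -> 0 < eta ->
  \forall r \near r0, forall y, II y -> `|F (r, y) - F (r0, y)| <= eta.
Proof.
move=> cF eta0.
have : compact (@II R) by exact: segment_compact.
rewrite compact_near_coveringP => /(_ R (nbhs r0) (fun r y => `|F (r, y) - F (r0, y)| <= eta)).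
apply=> y Iy.
have e20 : 0 < eta / 2 by rewrite divr_gt0.
have /cvgrPdist_le/(_ _ e20) H1 := cF (r0, y).
have [[U V] /= [Ur0 Vy] UV] := H1.
exists (V, U) => // -[y' r] /= [Vy' Ur].
have h1 := UV (r, y') (conj Ur Vy').
have h2 := UV (r0, y') (conj (nbhs_singleton Ur0) Vy').
rewrite /= in h1 h2; rewrite distrC in h1.
have -> : F (r, y') - F (r0, y') = (F (r, y') - F (r0, y)) + (F (r0, y) - F (r0, y')) by ring.
by apply: le_trans (ler_normD _ _) _; lra.
Qed.

Lemma continuous_bounded_Omega (Rad : R) (F : R * R -> R) : continuous F ->
  exists2 M, 0 <= M & forall p, Omega Rad p -> F p <= M.
Proof.
move=> cF; have /compact_bounded[M [_ hM]] : compact (F @` Omega Rad).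
  apply: continuous_compact; first exact: continuous_subspaceT.
  by apply: compact_setX; exact: segment_compact.
exists (`|M| + 1); first by rewrite addr_ge0.
move=> p Op; apply: le_trans (ler_norm _) _; apply: (hM (`|M| + 1)); last by exists p.
by rewrite (le_lt_trans (ler_norm _))// ltrDl.
Qed.

End Coefficients.

(** * The equation in real form and the continuity of its coefficients *)

Section Reduction.
Context {R : realType}.
Implicit Types (psi : R -> R[i]).

(** Agreement of the coefficients on I suffices, so [cr] and [ci] may come from extensions
    continuous on the whole plane. *)
Lemma ae_complex_solves (v : H2 R) (c : R -> R[i]) (cr ci : R -> R) psi :
  (forall y, II y -> c y = cr y +i* ci y) ->
  (fun y => - der2 v y - c y * fn v y) = psi %[ae leb R in II] ->
  solves v cr ci (re psi) (im psi).
Proof.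
move=> cE H; split; apply: (@filterS _ _ (ae_filter_ringOfSetsType (leb R)) _ _ _ H).
  move=> y /= Hy Iy; have := Hy Iy; rewrite (cE _ Iy) /re /im => <-.
  by case: (der2 v y) (fn v y) => ? ? [? ?] /=; ring.
move=> y /= Hy Iy; have := Hy Iy; rewrite (cE _ Iy) /re /im => <-.
by case: (der2 v y) (fn v y) => ? ? [? ?] /=; ring.
Qed.

(** One formula for both components: x is Re q or -Im q, y is |q|^2 and k is alpha^2 |q|^2. *)
Lemma coefficient_continuous (S : R -> R) (b : R * R -> R) (k x y : R) :
  continuous S -> continuous b ->
  continuous (fun p : R * R => S p.1 ^+ 2 / k * (x + y * b (p.1, p.2 * S p.1))).
Proof.
move=> cS cb p.
have cSp : S u.1 @[u --> p] --> S p.1.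
  exact: (continuous_comp (@cvg_fst _ _ _ _ _) (cS p.1)).
have cbp : b (u.1, u.2 * S u.1) @[u --> p] --> b (p.1, p.2 * S p.1).
  have sp : u.2 * S u.1 @[u --> p] --> p.2 * S p.1.
    by apply: cvgM => //; exact: cvg_snd.
  have fp : u.1 @[u --> p] --> p.1 by exact: cvg_fst.
  have pp : (u.1, u.2 * S u.1) @[u --> p] --> (p.1, p.2 * S p.1).
    exact: cvg_pair fp sp.
  by apply: (cvg_comp _ _ pp); exact: cb.
apply: cvgM; first by apply: cvgM; [rewrite !expr2; exact: cvgM|exact: cvg_cst].
by apply: cvgD; [exact: cvg_cst|apply: cvgM => //; exact: cvg_cst].
Qed.

Lemma section_continuous (F : R * R -> R) (r : R) :
  continuous F -> continuous (fun y => F (r, y)).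
Proof.
move=> cF y.
have rp : r @[_ --> y] --> r by exact: cvg_cst.
have yp : u @[u --> y] --> y by exact: cvg_id.
have pp : (r, u) @[u --> y] --> (r, y) by exact: cvg_pair rp yp.
by apply: (cvg_comp _ _ pp); exact: cF.
Qed.

End Reduction.

(** * Existence of the maximum over r *)

Section Continuity.
Context {R : realType}.

Lemma energy_max (Rad K : R) (T : R -> H2 R) (cr ci : R * R -> R) (f g : R -> R) :
  0 <= Rad -> 0 <= K -> continuous cr -> continuous ci ->
  (forall r, r \in `[0, Rad] -> in_H10 (T r)) ->
  (forall r, r \in `[0, Rad] ->
    solves (T r) (fun y => cr (r, y)) (fun y => ci (r, y)) f g) ->
  (forall r (w : H2 R) (f g : R -> R), r \in `[0, Rad] -> sqint f -> sqint g ->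
    in_H10 w -> solves w (fun y => cr (r, y)) (fun y => ci (r, y)) f g ->
    energy w <= K * (ip f f + ip g g)) ->
  exists2 r0, r0 \in `[0, Rad] &
    forall r, r \in `[0, Rad] -> energy (T r) <= energy (T r0).
Proof.
move=> Rad0 K0 ccr cci HT sT est.
apply: EVT_max => //; apply/subspace_continuousP => r0 /= r0A.
(* With E the energy at [r0] and eta <= 1, the final bound is (1 + 1/eta) 4 K eta^2 E + eta E <= eta
   (8 K + 1) E. It is at most eta P, hence at most e; the added 1 makes P positive. *)
pose P := energy (T r0) * (8 * K + 1) + 1.
have E0 : 0 <= energy (T r0) by rewrite /energy sqr_ge0.
have P0 : 0 < P by rewrite /P; nra.
apply/cvgrPdist_le => e e0.
pose eta := Num.min 1 (e / P).
have eta0 : 0 < eta by rewrite lt_min ltr01 divr_gt0.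
have eta1 : eta <= 1 by rewrite ge_min lexx.
have etaP : eta * P <= e by rewrite -ler_pdivlMr// ge_min lexx orbT.
have n1 := near_segment_uniform r0 ccr eta0.
have n2 := near_segment_uniform r0 cci eta0.
apply: filterS2 n1 n2 => r /= h1 h2 rA.
rewrite distrC.
(* eta serves both as the bound on the coefficients and as the Young parameter. *)
have := energy_near (T r) (T r0) eta0.
set w := H1B _ _ => le1; apply: le_trans le1 _.
set k := fun y => cr (r, y) - cr (r0, y) in h1.
set l := fun y => ci (r, y) - ci (r0, y) in h2.
have ck : continuous k by move=> y; apply: cvgB; exact: section_continuous.
have cl : continuous l by move=> y; apply: cvgB; exact: section_continuous.
have sw := solvesB (sT _ rA) (sT _ r0A).
have sa := sqint_re (fn_L2 (T r0)); have sb := sqint_im (fn_L2 (T r0)).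
have cl' : continuous (fun y => - l y) by move=> y; exact: cvgN (cl y).
have Ew : energy w <= K * (4 * eta ^+ 2 * energy (T r0)).
  apply: le_trans (est _ (H2B (T r) (T r0)) _ _ rA _ _ _ sw) _.
  - by apply: sqintB; exact: sqintM.
  - by apply: sqintB; exact: sqintM.
  - by apply: in_H10B; exact: HT.
  - rewrite ler_wpM2l//; exact: (@perturbation _ eta (T r0) k l ck cl (ltW eta0) h1 h2).
have : (1 + eta^-1) * energy w <= (1 + eta^-1) * (K * (4 * eta ^+ 2 * energy (T r0))).
  by rewrite ler_wpM2l// addr_ge0// invr_ge0 ltW.
have -> : (1 + eta^-1) * (K * (4 * eta ^+ 2 * energy (T r0))) =
    (eta + 1) * eta * (4 * K * energy (T r0)).
  by field; rewrite gt_eqF.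
have KE : 0 <= 4 * K * energy (T r0) by apply: mulr_ge0 => //; apply: mulr_ge0.
have : (eta + 1) * eta * (4 * K * energy (T r0)) <= 2 * eta * (4 * K * energy (T r0)).
  by rewrite ler_wpM2r//; nra.
rewrite /P in etaP; nra.
Qed.

End Continuity.

(** * The uniform bound for the inverse operators *)

Unset Implicit Arguments.

Theorem lemma3p1 (R : realType) (Rad alpha : R) (q : R[i]) (s : R -> R)
    (beta : R * R -> R[i]) (T : R -> (R -> R[i]) -> H2 R) (CPF : R)
    (hRad : 0 < Rad) (halpha : 0 < alpha) (hq : q != 0)
    (hs : smooth_on `[0, Rad]%classic s)
    (hs_pos : forall r, r \in `[0, Rad] -> 0 < s r)
    (hbeta : csmooth_on (domain Rad s) beta)
    (hT : forall r, r \in `[0, Rad] ->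
       is_inverse (Lambda alpha q s beta r) (T r))
    (hCPF : 0 < CPF) (hPF : Poincare_Friedrichs CPF)
    (hinf :
       0 < inf [set 1 / CPF ^+ 2
                 - s p.1 ^+ 2 / (alpha ^+ 2 * normc q ^+ 2)
                   * (complex.Re q + normc q ^+ 2 * complex.Re (gamma s beta p.1 p.2))
               | p in Omega Rad]
       \/
       exists delta : R, (delta = 1 \/ delta = -1) /\
       0 < inf [set delta * s p.1 ^+ 2 / (alpha ^+ 2 * normc q ^+ 2)
                   * (complex.Im q - normc q ^+ 2 * complex.Im (gamma s beta p.1 p.2))
               | p in Omega Rad]) :
  exists2 C : R, 0 < C &
    forall psi : R -> R[i], L2 psi ->
      exists2 m : R,
        is_max [set norm1 (T r psi) | r in `[0, Rad]%classic] m &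
        m <= C * norm0 psi.
Proof.
(* The smooth extensions replace [s] and [beta], so that the coefficients are continuous everywhere;
   on [Omega] their values are unchanged. *)
have [S sS SE] := hs; have [b1 sb1 b1E] := hbeta.1; have [b2 sb2 b2E] := hbeta.2.
have N0 := normc_sqr_gt0 hq.
set N := normc q ^+ 2 in hinf N0.
have a0 : alpha ^+ 2 != 0 by rewrite expf_neq0// gt_eqF.
pose cr (p : R * R) := S p.1 ^+ 2 / (alpha ^+ 2 * N) *
  (complex.Re q + N * b1 (p.1, p.2 * S p.1)).
pose ci (p : R * R) := S p.1 ^+ 2 / (alpha ^+ 2 * N) *
  (- complex.Im q + N * b2 (p.1, p.2 * S p.1)).
have ccr : continuous cr.
  by apply: coefficient_continuous; exact: smooth_continuous.
have cci : continuous ci.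
  by apply: coefficient_continuous; exact: smooth_continuous.
have dom r y : r \in `[0, Rad] -> II y -> domain Rad s (r, y * s r).
  move=> rA; rewrite /II /= in_itv /= => /andP[y0 y1].
  have sr := hs_pos r rA; move: rA; rewrite in_itv /= => rA; split=> //=.
  by rewrite mulr_ge0 ?(ltW sr)//= ler_piMl// ltW.
have SE' r : r \in `[0, Rad] -> S r = s r by move=> rA; exact: SE.
have crE r y : r \in `[0, Rad] -> II y -> cr (r, y) =
    s r ^+ 2 / (alpha ^+ 2 * N) * (complex.Re q + N * complex.Re (gamma s beta r y)).
  by move=> rA Iy; rewrite /cr /= SE'// b1E//; exact: dom.
have ciE r y : r \in `[0, Rad] -> II y -> ci (r, y) =
    s r ^+ 2 / (alpha ^+ 2 * N) * (N * complex.Im (gamma s beta r y) - complex.Im q).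
  by move=> rA Iy; rewrite /ci /= SE'// b2E ?[- _ + _]addrC//; exact: dom.
have sol psi r : L2 psi -> r \in `[0, Rad] ->
    solves (T r psi) (fun y => cr (r, y)) (fun y => ci (r, y)) (re psi) (im psi).
  move=> psi2 rA; have [_ eq _] := hT r rA psi psi2.
  apply: ae_complex_solves eq => y Iy.
  by rewrite quotient_components// crE// ciE.
have [M M0 crM] := continuous_bounded_Omega Rad ccr.
have OmegaI r y : r \in `[0, Rad] -> II y -> Omega Rad (r, y) by [].
have [kappa k0 coer] : exists2 kappa : R, 0 < kappa & forall r, r \in `[0, Rad] ->
    (forall y, II y -> kappa <= 1 / CPF ^+ 2 - cr (r, y)) \/
    (exists delta, (delta = 1 \/ delta = -1) /\
       forall y, II y -> kappa <= - (delta * ci (r, y))).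
  (* In either case [kappa] is the infimum itself, its positivity being the hypothesis. *)
  case: hinf => [h|[delta [d1 h]]]; eexists; try exact: h.
    move=> r rA; left=> y Iy; rewrite crE//; apply: inf_gt0_lbound => //.
    by exists (r, y); first exact: OmegaI.
  move=> r rA; right; exists delta; split=> // y Iy; rewrite ciE//.
  apply: inf_gt0_lbound => //; exists (r, y); first exact: OmegaI.
  by rewrite /=; ring.
pose K := (M + 2) / kappa ^+ 2 + 1.
have K0 : 0 < K by rewrite ltr_wpDl// divr_ge0 ?sqr_ge0// addr_ge0.
have est r (w : H2 R) (f g : R -> R) : r \in `[0, Rad] -> sqint f -> sqint g ->
    in_H10 w -> solves w (fun y => cr (r, y)) (fun y => ci (r, y)) f g ->
    energy w <= K * (ip f f + ip g g).
  move=> rA sf sg H10w solw.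
  apply: (a_priori (section_continuous (r := r) ccr)
    (section_continuous (r := r) cci) sf sg H10w solw hCPF k0 M0 hPF).
    by move=> y Iy; apply: crM; exact: OmegaI.
  exact: coer.
(* The estimate bounds the square of the norm by K |psi|^2, hence the square root. *)
exists (Num.sqrt K); first by rewrite sqrtr_gt0.
move=> psi psi2; have [spr spi] := (L2P psi).1 psi2.
have H10T r : r \in `[0, Rad] -> in_H10 (T r psi) by move=> rA; have [] := hT r rA psi psi2.
have [r0 r0A maxr0] := energy_max (T := fun r => T r psi) (ltW hRad) (ltW K0)
  ccr cci H10T (fun r => sol psi r psi2) est.
have le_norm1 (u : H1 R) (x : R) : 0 <= x -> energy u <= x ^+ 2 -> norm1 u <= x.
  by move=> x0; rewrite /energy ler_pXn2r// nnegrE graph_norm_ge0.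
exists (norm1 (T r0 psi)).
  split; first by exists r0.
  move=> _ [r rA <-]; apply: le_norm1; first exact: graph_norm_ge0.
  exact: maxr0.
apply: le_norm1; first by rewrite mulr_ge0 ?sqrtr_ge0.
rewrite exprMn sqr_sqrtr ?(ltW K0)// norm0_sqr//; apply: (est r0) => //.
  exact: H10T.
exact: sol.
Qed.
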